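(* Up to isomorphism of symmetric quandles, the only CNS-quandle of order $8$ or lower is the following symmetric Galkin quandle of order $6$: the pair $(\mathcal{G}(\mathbb{Z}/2\mathbb{Z},1),\rho_1)$, where $\rho_1(x,a)=(x,a+1)$ for all $(x,a)\in\mathbb{Z}/3\mathbb{Z}\times\mathbb{Z}/2\mathbb{Z}$.
   Context: A rack is a pair $R=(X,s)$ where $X$ is a nonempty set and $s:X\to S_X$, $x\mapsto s_x$, is a map to the symmetric group of $X$ with $s_xs_y=s_{s_x(y)}s_x$ for all $x,y\in X$; its order is $|X|$. It is a quandle if $s_x(x)=x$ for all $x$, and involutory if $s_x^2=\mathrm{id}_X$ for all $x$. It is connected if the group $\langle s_x\mid x\in X\rangle\leq S_X$ acts transitively on $X$. A good involution of $(X,s)$ is a map $\rho:X\to X$ with $\rho^2=\mathrm{id}_X$ such that $\rho s_x=s_x\rho$ and $s_{\rho(x)}=s_x^{-1}$ for all $x$. A symmetric quandle is a pair $(R,\rho)$ with $R$ a quandle and $\rho$ a good involution of $R$. A CNS-quandle is a symmetric quandle $(R,\rho)$ such that $R$ is connected and not involutory. A rack homomorphism $(X,s)\to(Y,t)$ is a map $\varphi$ with $\varphi s_x=t_{\varphi(x)}\varphi$ for all $x$; an isomorphism of symmetric quandles $(R_1,\rho_1)\to(R_2,\rho_2)$ is a bijective rack homomorphism $\varphi$ with $\varphi\rho_1=\rho_2\varphi$. Galkin quandles: for an additive abelian group $A$ and $c\in A$, define $\mu:\mathbb{Z}/3\mathbb{Z}\to\mathbb{Z}$ by $\mu(0)=2$,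 $\mu(1)=\mu(2)=-1$, and $\tau:\mathbb{Z}/3\mathbb{Z}\to A$ by $\tau(0)=\tau(1)=0$, $\tau(2)=c$. Then $\mathcal{G}(A,c)$ is the quandle on $\mathbb{Z}/3\mathbb{Z}\times A$ with $s_{(y,b)}(x,a)=(2y-x,\,-a+\mu(x-y)b+\tau(x-y))$. *)

(* Defs.v *)
From HB Require Import structures.
From mathcomp Require Import all_boot all_order all_algebra all_fingroup.

Set Implicit Arguments.
Unset Strict Implicit.
Unset Printing Implicit Defensive.

Import GRing.Theory.

(* A finite rack (X, s) is a finType X with s : X -> {perm X}.  The product of
   {perm X} composes from left to right, so equations between composites of
   the s_x are written pointwise. *)
Section Racks.

Variables (X : finType) (s : X -> {perm X}).

Definition is_rack : Prop :=
  0 < #|X| /\ forall x y z : X, s x (s y z) = s (s x y) (s x z).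

Definition is_quandle : Prop := is_rack /\ forall x : X, s x x = x.

Definition involutory : Prop := forall x : X, involutive (s x).

Definition connected : Prop :=
  [transitive <<[set s x | x in X]>>, on [set: X] | 'P].

Definition good_involution (rho : X -> X) : Prop :=
  [/\ involutive rho,
      forall x z : X, rho (s x z) = s x (rho z)
    & forall x : X, s (rho x) = (s x)^-1%g].

Definition symmetric_quandle (rho : X -> X) : Prop :=
  is_quandle /\ good_involution rho.

Definition CNS_quandle (rho : X -> X) : Prop :=
  [/\ symmetric_quandle rho, connected & ~ involutory].

End Racks.

Definition rack_hom (X Y : finType) (s : X -> {perm X}) (t : Y -> {perm Y})
    (phi : X -> Y) : Prop :=
  forall x z : X, phi (s x z) = t (phi x) (phi z).

Definition symmetric_quandle_isomorphic (X Y : finType)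
    (s : X -> {perm X}) (rho : X -> X)
    (t : Y -> {perm Y}) (sigma : Y -> Y) : Prop :=
  exists phi : X -> Y,
    [/\ bijective phi, rack_hom s t phi
      & forall x : X, phi (rho x) = sigma (phi x)].

Section Galkin.

Local Open Scope ring_scope.

Variables (A : finZmodType) (c : A).

Definition galkin_mu (x : 'Z_3) : int := if x == 0 then 2 else -1.

Definition galkin_tau (x : 'Z_3) : A := if x == 2 then c else 0.

Definition galkin_fun (u v : 'Z_3 * A) : 'Z_3 * A :=
  let: (y, b) := u in
  let: (x, a) := v in
  (2 * y - x, - a + b *~ galkin_mu (x - y) + galkin_tau (x - y)).

Lemma galkin_fun_inj (u : 'Z_3 * A) : injective (galkin_fun u).
Proof.
case: u => y b [x a] [x' a'] eq_im.
have ex : x = x' by exact/oppr_inj/(addrI (2 * y))/(congr1 fst eq_im).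
have /= := congr1 snd eq_im.
by rewrite ex => /addIr/addIr/oppr_inj ->.
Qed.

Definition galkin (u : 'Z_3 * A) : {perm 'Z_3 * A} := perm (@galkin_fun_inj u).

End Galkin.

Definition rho1 (u : 'Z_3 * 'Z_2) : 'Z_3 * 'Z_2 := (u.1, u.2 + 1)%R.

(* Main.v *)
Require Import Defs.
From mathcomp Require Import all_boot all_order all_algebra all_fingroup.

(* Every [s x] commutes with [rho], so it acts on the pairs [{u, rho u}], and it
   fixes the pair of [x].  As no [s x] is an involution, there are at least
   three pairs.  Suppose there are four.  If some [s x] fixes a second pair, it
   is a transposition on the pairs, and in each possible configuration of such
   transpositions a pair, or the union of two, is stable under all the [s z].
   Otherwise every [s x] is a 3-cycle on the pairs, and the orbit of [x]
   contains exactly one element of each pair, hence not [rho x].  Both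
   contradict connectedness.  With three pairs, [s x ^ 2] is [rho] off the pair
   of [x], and [s y x = rho (s x y)] whenever [x] and [y] lie in distinct pairs;
   these two rules determine the whole multiplication table. *)

Set Implicit Arguments.
Unset Strict Implicit.
Unset Printing Implicit Defensive.

Section ConnectedSymmetricQuandle.

Local Open Scope group_scope.

Variables (X : finType) (s : X -> {perm X}) (rho : X -> X).
Hypothesis cnsX : CNS_quandle s rho.

Let rackE x y z : s x (s y z) = s (s x y) (s x z).
Proof. by case: cnsX => [[[[_ +] _] _] _ _]; apply. Qed.

Let sxx x : s x x = x.
Proof. by case: cnsX => [[[_ +] _] _ _]; apply. Qed.

Let rhoK : involutive rho.
Proof. by case: cnsX => [[_ []]]. Qed.

Let s_rhoC x z : rho (s x z) = s x (rho z).
Proof. by case: cnsX => [[_ [_ + _]] _ _]; apply. Qed.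

Let s_rho x : s (rho x) = (s x)^-1%g.
Proof. by case: cnsX => [[_ [_ _ +]] _ _]; apply. Qed.

(** * Conjugation and connectedness *)

Lemma s_conj x y : s (s x y) = (s y ^ s x)%g.
Proof. by apply/permP => z; rewrite !permM -[z in LHS](permKV (s x)) -rackE. Qed.

(** Connectedness is always applied in this form: a set stable under the generators contains the
    orbit of each of its points. *)
Lemma stable_setT (O : {set X}) x :
  x \in O -> (forall z, s z \in 'N(O | 'P)) -> O = [set: X].
Proof.
move=> Ox sO; apply/eqP; rewrite eqEsubset subsetT /=; apply/subsetP => y _.
have sub : <<[set s z | z in X]>>%g \subset 'N(O | 'P).
  by rewrite gen_subG; apply/subsetP => _ /imsetP[z _ ->].
have conn : connected s by case: cnsX.
have : y \in orbit 'P <<[set s z | z in X]>>%g x.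
  by rewrite (atransP conn) ?inE.
by apply/subsetP: y; rewrite acts_sub_orbit.
Qed.

Lemma stabP (O : {set X}) (p : {perm X}) :
  {in O, forall v, p v \in O} -> p \in 'N(O | 'P).
Proof. by move=> pO; rewrite !inE; apply/subsetP => v /pO; rewrite !inE. Qed.

(* All the [s x] are conjugate, so none of them is an involution. *)
Lemma not_involutive x : ~ involutive (s x).
Proof.
move=> invx; pose O := [set u | [forall v, s u (s u v) == v]].
have Ox : x \in O by rewrite inE; apply/forallP => v; rewrite invx.
have OT : O = [set: X].
  apply: (stable_setT Ox) => z; apply: stabP => u; rewrite !inE => /forallP uu.
  apply/forallP => v; rewrite s_conj !permM permK (eqP (uu _)).
  by rewrite permKV.
case: cnsX => _ _; apply=> u v; apply/eqP; move: v; apply/forallP.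
by have := in_setT u; rewrite -OT inE.
Qed.

Lemma rho_neq x : rho x != x.
Proof.
apply/eqP => fx; apply: (@not_involutive x) => v.
by rewrite -{1}fx s_rho permK.
Qed.

(** * The pairs [{u, rho u}] and the action on them *)

Definition rho_pair u : {set X} := [set u; rho u].
Local Notation pr := rho_pair.

Lemma rho_pairP u v : reflect (u = v \/ u = rho v) (pr u == pr v).
Proof.
apply: (iffP eqP) => [e|[->|->] //].
  by have := set21 u (rho u); rewrite -/(pr u) e => /set2P.
by rewrite /pr rhoK setUC.
Qed.

Lemma rho_pair_rho u : pr (rho u) = pr u.
Proof. by apply/eqP/rho_pairP; right. Qed.

Lemma rho_pair_s z u v : (pr (s z u) == pr (s z v)) = (pr u == pr v).
Proof.
apply/rho_pairP/rho_pairP => -[e|e].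
- by left; apply: perm_inj e.
- by right; apply: (@perm_inj _ (s z)); rewrite -s_rhoC.
- by left; rewrite e.
- by right; rewrite e s_rhoC.
Qed.

Lemma eq_pair_s z u v : pr u = pr v -> pr (s z u) = pr (s z v).
Proof. by move/eqP; rewrite -(rho_pair_s z) => /eqP. Qed.

Lemma stab_pair u v (O : {set X}) :
  pr u = pr v -> (s u \in 'N(O | 'P)) = (s v \in 'N(O | 'P)).
Proof. by move/eqP/rho_pairP => [->//|->]; rewrite s_rho groupV. Qed.

(** [s (s u v)] is the conjugate of [s v] by [s u]. With [stab_pair], this reduces stability to a
    few of the [s z]. *)
Lemma stab_s u v (O : {set X}) :
  s u \in 'N(O | 'P) -> (s (s u v) \in 'N(O | 'P)) = (s v \in 'N(O | 'P)).
Proof. by move=> uO; rewrite s_conj groupJr. Qed.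

Definition pair_elements l : seq X := flatten [seq [:: u; rho u] | u <- l].

Lemma mem_pair_elements l v : (v \in pair_elements l) = (pr v \in map pr l).
Proof.
elim: l => //= u l IHl; rewrite !inE IHl orbA; congr (_ || _).
apply/orP/rho_pairP => -[].
- by move/eqP; left.
- by move/eqP; right.
- by move=> ->; left.
- by move=> ->; right.
Qed.

Lemma size_pair_elements l : size (pair_elements l) = (size l).*2.
Proof. by elim: l => //= u l ->. Qed.

Lemma uniq_pair_elements l : uniq (map pr l) -> uniq (pair_elements l).
Proof.
elim: l => //= u l IHl /andP[ul /IHl ->].
by rewrite !inE negb_or !mem_pair_elements rho_pair_rho ul eq_sym rho_neq.
Qed.

(** Since [rho] has no fixed point, one further pair would give at least [2 * (size l + 1)]
    elements. *)
Lemma pairs_cover l : uniq (map pr l) -> #|X| < (size l).+1.*2 ->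
  forall v, pr v \in map pr l.
Proof.
move=> uniql ltX v; apply: contraLR ltX => vl; rewrite -leqNgt.
rewrite -(size_pair_elements (v :: l)) -(card_uniqP _) ?max_card //.
by apply: uniq_pair_elements; rewrite /= vl.
Qed.

Lemma card_cover l : (forall v, pr v \in map pr l) -> #|X| <= (size l).*2.
Proof.
move=> cover; rewrite -size_pair_elements cardE uniq_leq_size ?enum_uniq //.
by move=> v _; rewrite mem_pair_elements.
Qed.

Lemma pair_s_inj z u v : pr (s z u) = pr (s z v) -> pr u = pr v.
Proof. by move/eqP; rewrite rho_pair_s => /eqP. Qed.

Lemma pair_s_eq_self z u : pr (s z u) = pr z -> pr u = pr z.
Proof. by rewrite -{2}(sxx z); apply: pair_s_inj. Qed.

Lemma pair_s_neq z u v : pr u <> pr v -> pr (s z u) <> pr (s z v).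
Proof. by move=> uv /pair_s_inj. Qed.

Lemma pair_s_neq_self z u : pr u <> pr z -> pr (s z u) <> pr z.
Proof. by move=> uz /pair_s_eq_self. Qed.

(** If [s x] fixed every pair, each [s x v] would be [v] or [rho v]; as [s x] commutes with [rho],
    its square would be the identity. *)
Lemma moved_pair x : exists a,
  [/\ pr (s x a) <> pr a, pr x <> pr a & pr x <> pr (s x a)].
Proof.
suff [a /eqP ab] : exists a, pr (s x a) != pr a.
  have xa : pr x <> pr a by move=> e; apply: ab; rewrite -e -(eq_pair_s x e) sxx.
  by exists a; split=> // /esym/pair_s_eq_self/esym.
apply/existsP; rewrite -negb_forall; apply/negP => /forallP fixx.
apply: (@not_involutive x) => v; case: (rho_pairP _ _ (fixx v)) => e.
  by rewrite !e.
by rewrite e -s_rhoC e rhoK.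
Qed.

(** With only three pairs, [s u] exchanges the two that do not contain [u]. Were its square not
    [rho] there, it would be the identity everywhere. *)
Lemma s2_rho u v : #|X| < 8 -> pr v != pr u -> s u (s u v) = rho v.
Proof.
move=> ltX; have [a] := moved_pair u; set b := s u a; case=> ab ua ub.
have cover w : [\/ pr w = pr u, pr w = pr a | pr w = pr b].
  have: pr w \in map pr [:: u; a; b].
    apply: pairs_cover => //=; rewrite !inE !negb_or andbT.
    rewrite (introN eqP ua) (introN eqP ub) /=.
    (* The bound 0 keeps [congruence] from instantiating the quandle axioms. *)
    by apply/eqP; congruence 0.
  by rewrite !inE => /or3P[]/eqP ->; [constructor 1|constructor 2|constructor 3].
have uba : s u b = rho a.
  case: (cover (s u b)) => [/pair_s_eq_self||/pair_s_inj] e; try congruence 0.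
  move/eqP/rho_pairP: e => [uba|//]; case: (@not_involutive u) => w.
  have inv_rho p : s u (s u p) = p -> s u (s u (rho p)) = rho p.
    by move=> e; rewrite -!s_rhoC e.
  case: (cover w) => /eqP/rho_pairP[]->; rewrite ?inv_rho ?sxx //;
    by rewrite -/b ?uba.
move/eqP; case: (cover v) => // /eqP/rho_pairP[]-> _.
- by [].
- by rewrite -!s_rhoC uba.
- by rewrite uba s_rhoC.
- by rewrite -!s_rhoC uba -s_rhoC.
Qed.

(** * Excluding four pairs *)

Lemma stab_pairs z q : {in q, forall u, pr (s z u) \in map pr q} ->
  s z \in 'N([set v | pr v \in map pr q] | 'P).
Proof.
move=> sq; apply: stabP => v; rewrite !inE => /mapP[u uq vu].
by rewrite (eq_pair_s z vu) sq.
Qed.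

Lemma no_stable_pairs l q x : (forall v, pr v \in map pr l) ->
  all (fun z => s z \in 'N([set v | pr v \in map pr q] | 'P)) l ->
  x \in q -> forall v, pr v \in map pr q.
Proof.
move=> cover /allP stab xq v; pose O := [set v | pr v \in map pr q].
suff OT : O = [set: X] by have := in_setT v; rewrite -OT inE.
apply: (@stable_setT _ x) => [|z]; first by rewrite inE map_f.
by have /mapP[u ul /stab_pair->] := cover z; apply: stab.
Qed.

Lemma uniq_pair4 p q r t : [/\ pr p <> pr q, pr p <> pr r & pr p <> pr t] ->
  [/\ pr q <> pr r, pr q <> pr t & pr r <> pr t] ->
  uniq (map pr [:: p; q; r; t]).
Proof.
case=> /eqP pq /eqP pt /eqP pu [/eqP qt /eqP qu /eqP tu].
by rewrite /= !inE !negb_or pq pt pu qt qu tu.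
Qed.

Lemma pair4_neq p q r t : uniq (map pr [:: p; q; r; t]) ->
  [/\ pr p <> pr q, pr p <> pr r & pr p <> pr t] /\
  [/\ pr q <> pr r, pr q <> pr t & pr r <> pr t].
Proof.
rewrite /= !inE !negb_or -!andbA => /and5P[/eqP pq /eqP pr /eqP pt /eqP qr].
by case/and3P=> /eqP qt /eqP rt _.
Qed.

Lemma pair4_cover p q r t : #|X| <= 8 -> uniq (map pr [:: p; q; r; t]) ->
  forall v, [\/ pr v = pr p, pr v = pr q, pr v = pr r | pr v = pr t].
Proof.
move=> leX /pairs_cover cover v.
have : pr v \in map pr [:: p; q; r; t].
  by apply: cover; apply: leq_ltn_trans leX _.
by rewrite !inE => /or4P[]/eqP ->;
  [constructor 1|constructor 2|constructor 3|constructor 4].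
Qed.

(** If [s x] fixed a second pair, that of [w], it would swap the remaining two, those of [a] and
    [b]. Depending on [s a], the pair of [w], that of [x] or the union of these two is then stable
    under every [s z]. *)
Lemma s_fixed_pair x w : #|X| <= 8 -> pr (s x w) = pr w -> pr x = pr w.
Proof.
move=> leX sxw; apply/eqP/negP => /negP/eqP xw.
(* Conjugation carries a second fixed pair of [s p] to one of [s (s z p)], so by connectedness every
   [s u] has one. *)
have fix2 u : exists2 v, pr u <> pr v & pr (s u v) = pr v.
  pose O := [set p | [exists q, (pr p != pr q) && (pr (s p q) == pr q)]].
  have Ox : x \in O.
    by rewrite inE; apply/existsP; exists w; rewrite sxw eqxx andbT; apply/eqP.
  have : u \in O.
    rewrite (stable_setT Ox) ?inE // => z; apply: stabP => p; rewrite !inE.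
    case/existsP=> q /andP[pq spq]; apply/existsP; exists (s z q).
    by rewrite -rackE !rho_pair_s pq.
  by rewrite inE => /existsP[q /andP[/eqP ? /eqP ?]]; exists q.
have [a] := moved_pair x; set b := s x a; case=> ab xa xb.
have aw : pr a <> pr w by move=> e; apply: ab; rewrite e -sxw; apply: eq_pair_s.
have wb : pr w <> pr b by rewrite -sxw => /pair_s_inj; congruence 0.
have uniq4 : uniq (map pr [:: x; a; b; w]).
  by apply: uniq_pair4; split; congruence 0.
have cover := pair4_cover leX uniq4.
(* The case of [b = s x a] follows from those of [x] and [a] by conjugation. *)
have not_stable y q : all (fun v => pr a != pr v) (y :: q) ->
    s x \in 'N([set v | pr v \in map pr (y :: q)] | 'P) ->
    s a \in 'N([set v | pr v \in map pr (y :: q)] | 'P) ->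
    s w \in 'N([set v | pr v \in map pr (y :: q)] | 'P) -> False.
  move=> aq sx sa sw; have : pr a \in map pr (y :: q).
    apply: (@no_stable_pairs [:: x; a; b; w] _ y); rewrite ?mem_head //.
      by apply: pairs_cover => //; apply: leq_ltn_trans leX _.
    by rewrite /= sx sa /b stab_s ?sa ?sw.
  by case/mapP=> v /(allP aq)/eqP.
have sx1 : s x \in 'N([set v | pr v \in map pr [:: x]] | 'P).
  by apply: stab_pairs => u; rewrite !inE => /eqP->; rewrite sxx.
have sx2 : s x \in 'N([set v | pr v \in map pr [:: x; w]] | 'P).
  apply: stab_pairs => u; rewrite !inE => /orP[]/eqP->;
  by rewrite ?sxx ?sxw eqxx ?orbT.
have [saw|/eqP saw] := eqVneq (pr (s a w)) (pr w).
  apply: (@not_stable w [::]); first by rewrite /= andbT; apply/eqP.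
  - by apply: stab_pairs => u; rewrite inE => /eqP->; rewrite sxw inE.
  - by apply: stab_pairs => u; rewrite inE => /eqP->; rewrite saw inE.
  - by apply: stab_pairs => u; rewrite inE => /eqP->; rewrite sxx inE.
have [sax|/eqP sax] := eqVneq (pr (s a x)) (pr x).
  have sa1 : s a \in 'N([set v | pr v \in map pr [:: x]] | 'P).
    by apply: stab_pairs => u; rewrite inE => /eqP->; rewrite sax inE.
  have sawb : pr (s a w) = pr b.
    case: (cover (s a w)) => // e.
    - by case: (@pair_s_neq a w x); congruence 0.
    - by case: (@pair_s_neq_self a w); congruence 0.
  apply: (@not_stable x [::]) => //; first by rewrite /= andbT eq_sym; apply/eqP.
  by rewrite -(stab_s w sa1) (stab_pair _ sawb) stab_s.
(* The second pair fixed by [s a] is neither that of [w] nor that of [x], so it is that of [b];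
   hence [s a] exchanges the pairs of [x] and [w]. *)
have sab : pr (s a b) = pr b.
  have [v av sav] := fix2 a; have := @eq_pair_s a v.
  by case: (cover v) => e /(_ _ e); congruence 0.
have saxw : pr (s a x) = pr w.
  case: (cover (s a x)) => // e.
  - by case: (@pair_s_neq_self a x); congruence 0.
  - by case: (@pair_s_neq a x b); congruence 0.
have sawx : pr (s a w) = pr x.
  case: (cover (s a w)) => // e.
  - by case: (@pair_s_neq_self a w); congruence 0.
  - by case: (@pair_s_neq a w b); congruence 0.
have sa2 : s a \in 'N([set v | pr v \in map pr [:: x; w]] | 'P).
  apply: stab_pairs => u; rewrite !inE => /orP[]/eqP->;
  by rewrite ?saxw ?sawx eqxx ?orbT.
apply: (@not_stable x [:: w]) => //; last by rewrite -(stab_pair _ saxw) stab_s.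
by rewrite /= andbT eq_sym; apply/andP; split; apply/eqP.
Qed.

(** By [s_fixed_pair], [s x] permutes the other three pairs without fixing any, hence cyclically,
    and one value determines the cycle. *)
Lemma s_cycle3 x p q r : #|X| <= 8 -> uniq (map pr [:: x; p; q; r]) ->
  pr (s x p) = pr q -> pr (s x q) = pr r /\ pr (s x r) = pr p.
Proof.
move=> leX uniq4 xp; have cover := pair4_cover leX uniq4.
have [[neq1 neq2 neq3] [neq4 neq5 neq6]] := pair4_neq uniq4.
have inj := @pair_s_neq x; have self := @pair_s_eq_self x.
have nofix v := @s_fixed_pair x v leX.
have xqr : pr (s x q) = pr r.
  case: (cover (s x q)) => // e; [|exfalso|].
  - by have := self _ e; congruence 0.
  - case: (cover (s x r)) => e'.
    + by have := self _ e'; congruence 0.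
    + by case: (inj r q); congruence 0.
    + by case: (inj r p); congruence 0.
    + by have := nofix _ e'; congruence 0.
  - by have := nofix _ e; congruence 0.
split=> //; case: (cover (s x r)) => // e.
- by have := self _ e; congruence 0.
- by case: (inj r p); congruence 0.
- by have := nofix _ e; congruence 0.
Qed.

Lemma s_braid u v b c : #|X| <= 8 -> uniq (map pr [:: u; v; b; c]) ->
  pr (s u v) = pr b -> pr (s v u) = pr c -> s u (s v u) = v.
Proof.
move=> leX uniq4 uv vu.
have [[uv' ub uc] [vb vc bc]] := pair4_neq uniq4.
have [ubc ucv] := s_cycle3 leX uniq4 uv.
have [vcb vbu] : pr (s v c) = pr b /\ pr (s v b) = pr u.
  by apply: s_cycle3 => //; apply: uniq_pair4; split; congruence 0.
have : pr (s u (s v u)) = pr v by rewrite -ucv; apply: eq_pair_s.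
(* The value [rho v] is excluded by computing the pair of [s v (s u (s d u))] twice:
   self-distributivity gives that of [u], the 3-cycles give that of [b]. *)
case/eqP/rho_pairP=> // eq_rho; exfalso; set d := s v u in eq_rho vu.
have dv : pr (s d v) = pr u.
  by rewrite -vbu -(eq_pair_s v uv) rackE sxx.
have [dub _] : pr (s d u) = pr b /\ pr (s d b) = pr v.
  by apply: s_cycle3 => //; apply: uniq_pair4; split; congruence 0.
have : pr (s v (s u (s d u))) = pr u.
  by rewrite [s u (s d u)]rackE eq_rho sxx s_rho permKV.
have := eq_pair_s v (eq_pair_s u dub); have := eq_pair_s v ubc; congruence 0.
Qed.

(* Otherwise [{x, a, b, c}] is stable under all the [s z]. *)
Lemma no_cycle3 x a (b := s x a) (c := s x b) : #|X| <= 8 ->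
  uniq (map pr [:: x; a; b; c]) -> pr (s a x) <> pr c.
Proof.
move=> leX uniq4 sax; have [[xa xb xc] [ab ac bc]] := pair4_neq uniq4.
have [_ xca] : pr (s x b) = pr c /\ pr (s x c) = pr a by apply: s_cycle3.
have [acb abx] : pr (s a c) = pr b /\ pr (s a b) = pr x.
  by apply: s_cycle3 => //; apply: uniq_pair4; split; congruence 0.
have sbx : s b x = a.
  by rewrite -(s_braid leX uniq4 (erefl _) sax) rackE sxx.
have scx : s c x = b by rewrite /c -{2}(sxx x) -rackE sbx.
(* The value [rho a] would give [s a c = x], while [s a c] lies in the pair of [b]. *)
have scxa : s x c = a.
  have dx : s (s x c) x = c by rewrite -{2}(sxx x) -rackE scx.
  case/eqP/rho_pairP: xca => // d; case: xb; rewrite -acb -[in s a c]dx d s_rho.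
  by rewrite permKV.
have sax_c : s a x = c by rewrite -{1}scxa -{2}(sxx x) -rackE scx.
have sab : s a b = x.
  by apply: (@s_braid a x c b) => //; apply: uniq_pair4; split; congruence 0.
have sac : s a c = b by rewrite -scx -{1}sab -{2}sax_c -rackE.
pose O := [set x; a; b; c]; have Ox : x \in O by rewrite !inE eqxx.
have sxO : s x \in 'N(O | 'P).
  apply: stabP => v; rewrite !inE -!orbA => /or4P[]/eqP->;
  by rewrite -?/b -?/c ?sxx ?scxa eqxx ?orbT.
have saO : s a \in 'N(O | 'P).
  apply: stabP => v; rewrite !inE -!orbA => /or4P[]/eqP->;
  by rewrite ?sxx ?sax_c ?sab ?sac eqxx ?orbT.
have OT : O = [set: X].
  apply: (stable_setT Ox) => z.
  by case: (pair4_cover leX uniq4 z) => /stab_pair-> //; rewrite !stab_s.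
have := in_setT (rho x); rewrite -OT !inE -!orbA (negPf (rho_neq x)) /=.
by case/or3P=> /eqP/(congr1 pr); rewrite rho_pair_rho.
Qed.

Lemma CNS_card_lt8 : #|X| <= 8 -> #|X| < 8.
Proof.
move=> leX; have /card_gt0P[x _] : 0 < #|X|.
  by case: cnsX => [[[[+ _] _] _] _ _].
have [a] := moved_pair x; set b := s x a; case=> ab xa xb.
have [cover|] := boolP [forall v, pr v \in map pr [:: x; a; b]].
  apply: (@leq_ltn_trans 6) => //.
  by apply: (@card_cover [:: x; a; b]); apply/forallP.
rewrite negb_forall => /existsP[w].
rewrite !inE !negb_or => /and3P[/eqP wx /eqP wa /eqP wb]; exfalso.
have uniq4w : uniq (map pr [:: x; a; b; w]).
  by apply: uniq_pair4; split; congruence 0.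
(* As [s x] cycles the other three pairs, [c] lies in the pair of [w] and can replace it. *)
have [cw _] := s_cycle3 leX uniq4w (erefl _); set c := s x b in cw.
have uniq4 : uniq (map pr [:: x; a; b; c]).
  by apply: uniq_pair4; split; congruence 0.
case: (pair4_cover leX uniq4 (s a x)) => e.
- by have := s_fixed_pair leX e; congruence 0.
- by have := pair_s_eq_self e; congruence 0.
- have [_ acx] : pr (s a b) = pr c /\ pr (s a c) = pr x.
    by apply: s_cycle3 => //; apply: uniq_pair4; split; congruence 0.
  (* Replacing [a] by [rho a] inverts [s a], which reduces this case to the other one. *)
  apply: (@no_cycle3 x (rho a) leX).
    by rewrite -!s_rhoC /= !rho_pair_rho.
  by rewrite -!s_rhoC rho_pair_rho s_rho; apply: (@pair_s_inj a); rewrite permKV.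
- exact: (no_cycle3 leX uniq4 e).
Qed.

(** * The second multiplication rule for three pairs *)

Lemma s_swap x y : #|X| < 8 -> pr x <> pr y -> s y x = rho (s x y).
Proof.
move=> ltX xy; have leX := ltnW ltX.
have yx : pr y <> pr x by congruence 0.
have zy : pr (s x y) <> pr y by move/(s_fixed_pair leX).
have zx : pr (s x y) <> pr x by move/pair_s_eq_self.
have yxx : pr (s y x) <> pr x by move/(s_fixed_pair leX).
have yxy : pr (s y x) <> pr y by move/pair_s_eq_self.
have : pr (s y x) \in map pr [:: x; y; s x y].
  apply: pairs_cover => //=; rewrite !inE !negb_or andbT.
  by apply/andP; split; [apply/andP; split|]; apply/eqP; congruence 0.
rewrite !inE => /or3P[/eqP//|/eqP//|/rho_pairP[yxz|//]]; exfalso.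
(* If [s y x = s x y], the identities below compute [s (s x y) (s (s x y) x)] both as [rho x] and as
   [x]. *)
have xz : s x (s x y) = s (s x y) x by rewrite -{1}yxz rackE sxx.
have szy : s (s x y) y = rho x.
  by rewrite -{1}yxz -{2}(sxx y) -rackE -yxz s2_rho //; apply/eqP.
have : s (s x y) (s (s x y) x) = rho x.
  by apply: s2_rho => //; apply/eqP; congruence 0.
rewrite -xz s2_rho //; last exact/eqP.
by rewrite -s_rhoC szy rhoK => /esym/eqP; rewrite (negPf (rho_neq x)).
Qed.

End ConnectedSymmetricQuandle.

(** * The symmetric Galkin quandle of order 6 *)

Lemma card_Z3Z2 : #|{: 'Z_3 * 'Z_2}| = 6.
Proof. by rewrite card_prod !card_ord. Qed.

(** Reduces to closed elements, on which the Galkin equations are decided by computation. *)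
Lemma Z3Z2_ind (P : 'Z_3 * 'Z_2 -> Prop) :
  P (0, 0)%R -> P (0, 1)%R -> P (1, 0)%R -> P (1, 1)%R -> P (2, 0)%R ->
  P (2, 1)%R -> forall u, P u.
Proof.
move=> P00 P01 P10 P11 P20 P21 [[[|[|[|//]]] lt3] [[|[|//]] lt2]].
- by rewrite (_ : (_, _) = (0, 0)%R) //; apply/eqP.
- by rewrite (_ : (_, _) = (0, 1)%R) //; apply/eqP.
- by rewrite (_ : (_, _) = (1, 0)%R) //; apply/eqP.
- by rewrite (_ : (_, _) = (1, 1)%R) //; apply/eqP.
- by rewrite (_ : (_, _) = (2, 0)%R) //; apply/eqP.
- by rewrite (_ : (_, _) = (2, 1)%R) //; apply/eqP.
Qed.

Lemma galkin_CNS : CNS_quandle (galkin (1%R : 'Z_2)) rho1.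
Proof.
have galE u v : galkin (1%R : 'Z_2) u v = galkin_fun 1%R u v by rewrite permE.
have quandleG : is_quandle (galkin (1%R : 'Z_2)).
  split; first split; first by rewrite card_Z3Z2.
    move=> x y z; rewrite !galE; apply/eqP.
    by elim/Z3Z2_ind: x; elim/Z3Z2_ind: y; elim/Z3Z2_ind: z.
  by move=> x; rewrite galE; apply/eqP; elim/Z3Z2_ind: x.
split.
- split=> //; split.
  + by elim/Z3Z2_ind; apply/eqP.
  + move=> x z; rewrite !galE; apply/eqP.
    by elim/Z3Z2_ind: x; elim/Z3Z2_ind: z.
  + move=> x; apply/permP => z; apply: (canRL (permK _)).
    rewrite !galE; apply/eqP.
    by elim/Z3Z2_ind: x; elim/Z3Z2_ind: z.
- rewrite /connected; set G := <<_>>%g.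
  have orbG u v w : v \in orbit 'P G (0, 0)%R -> galkin_fun 1%R u v == w ->
      w \in orbit 'P G (0, 0)%R.
    rewrite -galE => /orbitP[g Gg <-] /eqP<-.
    rewrite -[X in X \in _]/('P%act _ (galkin _ u)) -actM; apply: mem_orbit.
    by rewrite groupM // mem_gen //; apply: imset_f.
  have o00 := orbit_refl 'P G (0, 0)%R.
  apply/imsetP; exists (0, 0)%R => //; apply/eqP.
  rewrite eq_sym eqEsubset subsetT /=; apply/subsetP => v _.
  (* [(0, 1)] is reached from [(0, 0)] in two moves, every other point in at most one. *)
  elim/Z3Z2_ind: v => //.
  + apply: (orbG (2, 0)%R (1, 0)%R) => //.
    exact: (orbG (2, 0)%R (0, 0)%R).
  + exact: (orbG (2, 0)%R (0, 0)%R).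
  + exact: (orbG (2, 1)%R (0, 0)%R).
  + exact: (orbG (1, 1)%R (0, 0)%R).
  + exact: (orbG (1, 0)%R (0, 0)%R).
(* The square of the permutation at [(0, 0)] sends [(1, 0)] to [(1, 1)]. *)
- by move/(_ (0, 0)%R (1, 0)%R); rewrite !galE.
Qed.

(** * The isomorphism with the Galkin quandle *)

Lemma galkin_isomorphic (X : finType) (s : X -> {perm X}) (rho : X -> X) :
  #|X| < 8 -> CNS_quandle s rho ->
  symmetric_quandle_isomorphic s rho (galkin (1%R : 'Z_2)) rho1.
Proof.
move=> ltX cnsX; have [[[_ sxx] [rhoK s_rhoC s_rho]] _ _] := cnsX.
have [[_ [rho1K g_rhoC g_rho]] _ _] := galkin_CNS.
have /card_gt0P[x _] : 0 < #|X| by case: cnsX => [[[[+ _] _] _] _ _].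
have [y] := moved_pair cnsX x; set z := s x y; case=> yz xy xz.
have uniq3 : uniq (map (rho_pair rho) [:: x; y; z]).
  rewrite /= !inE !negb_or andbT (introN eqP xy) (introN eqP xz) /=.
  by apply/eqP => e; case: yz.
(* The labels fit because the Galkin permutation at [(0, 0)] sends [(1, 0)] to [(2, 0)], just as
   [s x y = z]. *)
pose psi (u : 'Z_3 * 'Z_2) :=
  let v := nth x [:: x; y; z] u.1 in if u.2 == 0%R then v else rho v.
have psi_rho u : psi (rho1 u) = rho (psi u).
  by elim/Z3Z2_ind: u; rewrite /psi /= ?rhoK.
have psiP v : exists u, psi u = v.
  have : v \in pair_elements rho [:: x; y; z].
    by rewrite (mem_pair_elements cnsX); apply: (pairs_cover cnsX).
  rewrite !inE => /or4P[|||/or3P[]] /eqP->.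
  - by exists (0, 0)%R.
  - by exists (0, 1)%R.
  - by exists (1, 0)%R.
  - by exists (1, 1)%R.
  - by exists (2, 0)%R.
  - by exists (2, 1)%R.
have sq u v : rho_pair rho v <> rho_pair rho u -> s u (s u v) = rho v.
  by move/eqP; apply: (s2_rho cnsX).
have swap u v : rho_pair rho u <> rho_pair rho v -> s v u = rho (s u v).
  exact: (s_swap cnsX ltX).
have sxz : s x z = rho y by apply: sq; congruence 0.
have syx : s y x = rho z by apply: swap.
have szx : s z x = y by rewrite (swap x z xz) sxz rhoK.
have syz : s y z = x.
  by apply: (inv_inj rhoK); rewrite s_rhoC -syx sq.
have szy : s z y = rho x by rewrite swap ?syz //; congruence 0.
have rho1_0 u : u.2 != 0%R -> (rho1 u).2 = 0%R.
  by elim/Z3Z2_ind: u => // _; apply/eqP.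
have psi_hom u v : s (psi u) (psi v) = psi (galkin (1%R : 'Z_2) u v).
  (* Passing from [u] to [rho1 u] inverts the permutations on both sides, so second coordinate 0
     suffices. *)
  wlog u0 : u v / u.2 = 0%R.
    move=> H; have [|u1] := eqVneq u.2 0%R; first exact: H.
    have eu : rho1 (rho1 u) = u by exact: rho1K.
    rewrite -eu psi_rho s_rho g_rho; apply: (perm_inj (s := s (psi (rho1 u)))).
    by rewrite permKV H ?permKV // rho1_0.
  wlog v0 : v / v.2 = 0%R.
    move=> H; have [|v1] := eqVneq v.2 0%R; first exact: H.
    rewrite -(rho1K v); move: (rho1 v) (rho1_0 _ v1) => w w0.
    by rewrite -g_rhoC !psi_rho -s_rhoC H.
  elim/Z3Z2_ind: u u0 => // _; elim/Z3Z2_ind: v v0 => // _;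
  by rewrite permE /psi /= -?/z ?sxx ?sxz ?syx ?syz ?szx ?szy.
have psiK v : exists u, psi u == v by have [u <-] := psiP v; exists u.
(* [phi] is a section of [psi], hence injective; it is bijective because three distinct pairs give
   [X] at least 6 elements. *)
pose phi v := xchoose (psiK v); have phiK : cancel phi psi.
  by move=> v; apply/eqP; apply: (xchooseP (psiK v)).
have phi_bij : bijective phi.
  apply: inj_card_bij (can_inj phiK) _; rewrite card_Z3Z2.
  rewrite -[6]/(size (pair_elements rho [:: x; y; z])).
  by rewrite -(card_uniqP (uniq_pair_elements cnsX uniq3)) max_card.
have psiKV : cancel psi phi by apply/(bij_can_sym phi_bij).
exists phi; split=> // [u v|u].
- by rewrite -{1}(phiK u) -{1}(phiK v) psi_hom psiKV.
- by rewrite -{1}(phiK u) -psi_rho psiKV.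
Qed.

Theorem proposition1p5 :
  [/\ CNS_quandle (galkin (1%R : 'Z_2)) rho1,
      #|{: 'Z_3 * 'Z_2}| = 6
    & forall (X : finType) (s : X -> {perm X}) (rho : X -> X),
        #|X| <= 8 -> CNS_quandle s rho ->
        symmetric_quandle_isomorphic s rho (galkin (1%R : 'Z_2)) rho1].
Proof.
split; [exact: galkin_CNS | exact: card_Z3Z2 |] => X s rho leX cnsX.
by apply: galkin_isomorphic => //; apply: CNS_card_lt8 cnsX leX.
Qed.
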